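(* Let $(M,g)$ be a closed Riemannian 3-manifold with constant scalar curvature $S$. Suppose there exist a nowhere vanishing smooth vector field $k$ on $M$ and a constant $\lambda\in\mathbb{R}$ such that $\mathrm{Ric}(k,\cdot)=0$ (i.e. $k$ lies in the zero eigenspace of the Ricci tensor at every point) and $\mathrm{Ric}+\tfrac12\mathscr{L}_k g=\tfrac{\lambda}{2}g$ (i.e. $(M,g,k)$ is a Ricci soliton with constant $\lambda$). Then $\lambda=S$. Moreover, if $S=0$, then $(M,g)$ is flat.
   Context: Closed means compact without boundary. $\mathrm{Ric}$ is the Ricci tensor of $g$ and $\mathscr{L}$ denotes the Lie derivative. A Ricci soliton $(M,g,k)$ with constant $\lambda$ is a Riemannian manifold with a vector field $k$ satisfying $\mathrm{Ric}+\tfrac12\mathscr{L}_k g=\tfrac{\lambda}{2}g$ (note the normalization $\lambda/2$). The zero eigenspace of the Ricci tensor at $p$ is $\{X\in T_pM : \mathrm{Ric}_p(X,\cdot)=0\}$. *)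

(* Defs.v *)
From HB Require Import structures.
From mathcomp Require Import all_boot all_order all_algebra.
From mathcomp Require Import all_classical all_reals all_analysis.

Set Implicit Arguments.
Unset Strict Implicit.
Unset Printing Implicit Defensive.

Import Order.TTheory GRing.Theory Num.Theory.
Import numFieldNormedType.Exports.

Local Open Scope classical_set_scope.
Local Open Scope ring_scope.

Section SmoothFunctions.
Context {R : realType} {n : nat}.

Definition partial (i : 'I_n) (f : 'rV[R]_n -> R) : 'rV[R]_n -> R :=
  fun x => 'D_(delta_mx 0 i) f x.

(* C^oo on the open set A: all iterated partial derivatives exist and are     *)
(* continuous at the points of A. The operator 'D is total, hence the         *)
(* explicit derivability clause.                                              *)
Definition smooth_on (A : set 'rV[R]_n) (f : 'rV[R]_n -> R) : Prop :=
  forall (s : seq 'I_n) (x : 'rV[R]_n), A x ->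
    {for x, continuous (foldr partial f s)} /\
    (forall i : 'I_n, derivable (foldr partial f s) x (delta_mx 0 i)).

Definition smooth_mx_on (p q : nat) (A : set 'rV[R]_n)
    (F : 'rV[R]_n -> 'M[R]_(p, q)) : Prop :=
  forall i j, smooth_on A (fun x => F x i j).

End SmoothFunctions.

Section LocalGeometry.
Context {R : realType} {n : nat}.
(* components g_ij of a metric and k^i of a vector field in one coordinate    *)
(* system; vectors are rows                                                   *)
Implicit Types (g : 'rV[R]_n -> 'M[R]_n) (k : 'rV[R]_n -> 'rV[R]_n).
Implicit Types (x : 'rV[R]_n).

(* Gamma^l_ij = 1/2 g^lm (d_i g_jm + d_j g_im - d_m g_ij) *)
Definition christoffel g (l i j : 'I_n) x : R :=
  2^-1 * \sum_(m < n) invmx (g x) l m *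
    (partial i (fun y => g y j m) x + partial j (fun y => g y i m) x
     - partial m (fun y => g y i j) x).

(* coefficient of d_l in R(d_i, d_j) d_k, where                               *)
(* R(X, Y) Z = D_X D_Y Z - D_Y D_X Z - D_[X, Y] Z                             *)
Definition riemann g (l i j k : 'I_n) x : R :=
  partial i (christoffel g l j k) x - partial j (christoffel g l i k) x
  + \sum_(m < n) (christoffel g m j k x * christoffel g l i m x
                  - christoffel g m i k x * christoffel g l j m x).

(* Ric(Y, Z) = tr (X |-> R(X, Y) Z) *)
Definition ricci g x : 'M[R]_n :=
  \matrix_(j, k) \sum_(i < n) riemann g i i j k x.

Definition scalar_curvature g x : R :=
  \sum_(i < n) \sum_(j < n) invmx (g x) i j * ricci g x i j.

(* (L_k g)_ij = k^l d_l g_ij + g_lj d_i k^l + g_il d_j k^l *)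
Definition lie_derivative k g x : 'M[R]_n :=
  \matrix_(i, j) \sum_(l < n)
    (k x 0 l * partial l (fun y => g y i j) x
     + g x l j * partial i (fun y => k y 0 l) x
     + g x i l * partial j (fun y => k y 0 l) x).

End LocalGeometry.

(* A homeomorphism from an open subset of M onto an open subset of R^n; the   *)
(* values of chart_map off chart_dom and of chart_inv off the image are junk. *)
Record chart (R : realType) (n : nat) (M : topologicalType) := Chart {
  chart_dom : set M;
  chart_map : M -> 'rV[R]_n;
  chart_inv : 'rV[R]_n -> M;
  chart_img := chart_map @` chart_dom;
  chart_dom_open : open chart_dom;
  chart_img_open : open chart_img;
  chart_mapK : forall p, chart_dom p -> chart_inv (chart_map p) = p;
  chart_map_continuous : {within chart_dom, continuous chart_map};
  chart_inv_continuous : {within chart_img, continuous chart_inv}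
}.

Definition transition (R : realType) (n : nat) (M : topologicalType)
    (c d : chart R n M) : 'rV[R]_n -> 'rV[R]_n :=
  chart_map d \o chart_inv c.

(* Smooth n-manifolds without boundary; the smooth structure is the one       *)
(* generated by the (not necessarily maximal) atlas.                          *)
Record smoothManifold (R : realType) (n : nat) := SmoothManifold {
  manifold_space :> topologicalType;
  manifold_hausdorff : hausdorff_space manifold_space;
  manifold_second_countable : @second_countable manifold_space;
  atlas : set (chart R n manifold_space);
  atlas_cover : forall p, exists2 c, atlas c & chart_dom c p;
  atlas_smooth : forall c d, atlas c -> atlas d ->
    smooth_mx_on (chart_map c @` (chart_dom c `&` chart_dom d))
      (transition c d)
}.

(* Tensor fields are given by their components in the charts of the atlas, as *)
(* functions on the chart images, subject to the tensor transformation law.   *)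
(* With row vectors, (jacobian f x) i j is the i-th partial derivative of the *)
(* j-th component of f at x.                                                  *)
Record vectorField (R : realType) (n : nat) (M : smoothManifold R n) :=
  VectorField {
  vf_comp :> chart R n M -> 'rV[R]_n -> 'rV[R]_n;
  vf_smooth : forall c, atlas c -> smooth_mx_on (chart_img c) (vf_comp c);
  vf_transform : forall c d p, atlas c -> atlas d ->
    chart_dom c p -> chart_dom d p ->
    vf_comp d (chart_map d p) =
      vf_comp c (chart_map c p) *m jacobian (transition c d) (chart_map c p)
}.

Record riemannianMetric (R : realType) (n : nat) (M : smoothManifold R n) :=
  RiemannianMetric {
  metric_comp :> chart R n M -> 'rV[R]_n -> 'M[R]_n;
  metric_smooth : forall c, atlas c ->
    smooth_mx_on (chart_img c) (metric_comp c);
  metric_sym : forall c x, atlas c -> chart_img c x ->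
    (metric_comp c x)^T = metric_comp c x;
  metric_posdef : forall c x, atlas c -> chart_img c x ->
    forall v : 'rV[R]_n, v != 0 -> 0 < (v *m metric_comp c x *m v^T) 0 0;
  metric_transform : forall c d p, atlas c -> atlas d ->
    chart_dom c p -> chart_dom d p ->
    let J := jacobian (transition c d) (chart_map c p) in
    metric_comp c (chart_map c p) = J *m metric_comp d (chart_map d p) *m J^T
}.

Section GlobalNotions.
Context {R : realType} {n : nat} {M : smoothManifold R n}.
Implicit Types (g : riemannianMetric M) (k : vectorField M).

(* absence of boundary is part of smoothManifold *)
Definition closed_manifold (N : smoothManifold R n) : Prop :=
  compact [set: N].

Definition nowhere_vanishing k : Prop :=
  forall c x, atlas c -> chart_img c x -> k c x != 0.

Definition has_constant_scalar_curvature g (S : R) : Prop :=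
  forall c x, atlas c -> chart_img c x -> scalar_curvature (g c) x = S.

Definition in_ricci_kernel g k : Prop :=
  forall c x, atlas c -> chart_img c x -> k c x *m ricci (g c) x = 0.

Definition ricci_soliton g k (lambda : R) : Prop :=
  forall c x, atlas c -> chart_img c x ->
    ricci (g c) x + 2^-1 *: lie_derivative (k c) (g c) x
      = (lambda / 2) *: g c x.

Definition flat g : Prop :=
  forall c x, atlas c -> chart_img c x ->
    forall l i j m : 'I_n, riemann (g c) l i j m x = 0.

End GlobalNotions.

(* Main.v *)
Require Import Defs.
From mathcomp Require Import all_boot all_order all_algebra.
From mathcomp Require Import all_classical all_reals all_analysis.
From HB Require Import structures.
From mathcomp Require Import ring lra.

(** At a maximum of [|k|^2] the soliton equation evaluated on [(k, k)] reads
    [0 = k(|k|^2) = lambda |k|^2], because [Ric(k, k) = 0]; hence [lambda = 0].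
    The vector field [Ric(k)^#] vanishes, hence so does its divergence, which is
    [<div Ric, k> + <Ric, nabla k>].  The contracted Bianchi identity turns the
    first term into [dS(k) / 2 = 0], and the soliton equation turns the second
    one into [<Ric, L_k g> / 2 = - |Ric|^2].  So [Ric = 0], hence [S = 0], and in
    dimension 3 the Ricci tensor determines the curvature.

    These tensor identities hold over any commutative ring with commuting
    derivations; here it is the ring of smooth functions on the image of a chart. *)

Set Implicit Arguments.
Unset Strict Implicit.
Unset Printing Implicit Defensive.

Import Order.TTheory GRing.Theory Num.Theory.
Import numFieldNormedType.Exports.

Local Open Scope classical_set_scope.
Local Open Scope ring_scope.

(** * Levi-Civita connections over a differential ring *)

(** The obstacle is the calculus. Since ['D] is total, each rewriting of a derivative carries
    derivability conditions on an open set, and the Bianchi identity involves third derivatives of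
    the metric. A ring of smooth functions settles these conditions once, and tensor calculus
    becomes matrix algebra closed by [ring]. In such a ring a nonzero element need not be
    invertible: one half is a given element or is replaced by cancelling [a + a = 0], the inverse
    metric is a given matrix, and positivity enters only after evaluation at a point. There |Ric|^2
    is the trace of T H T H, with T the Ricci tensor and H the inverse metric, and its vanishing
    forces T = 0 because H is positive definite. The pairing <Ric, nabla k> sees only the symmetric
    part of nabla k, because Ric is symmetric; that part is half of L_k g. *)

Lemma addmxE (V : nmodType) p q (M N : 'M[V]_(p, q)) i j :
  (M + N) i j = M i j + N i j.
Proof. by rewrite mxE. Qed.

Lemma oppmxE (V : zmodType) p q (M : 'M[V]_(p, q)) i j : (- M) i j = - M i j.
Proof. by rewrite mxE. Qed.

Section LeviCivita.
Context {K : comPzRingType} {n : nat}.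
Variables (d : 'I_n -> {additive K -> K}) (half : K) (g h : 'M[K]_n).
Hypothesis half2 : half + half = 1.
Hypothesis hg : h *m g = 1%:M.
Hypothesis g_sym : g^T = g.
Hypothesis h_sym : h^T = h.

(** The Koszul formula in a coordinate frame. The contravariant index is the column, so that these
    matrices act on row vectors from the right. *)
Definition levi_civita (i : 'I_n) : 'M[K]_n := \matrix_(k, l)
  (half * \sum_m h l m * (d i (g k m) + d k (g i m) - d m (g i k))).

Lemma levi_civita_torsion_free i j l : levi_civita i j l = levi_civita j i l.
Proof.
rewrite !mxE; congr (_ * _); apply: eq_bigr => m _; congr (_ * _).
have gij : g i j = g j i by rewrite -{1}g_sym mxE.
by rewrite gij [d i _ + _]addrC.
Qed.

Lemma levi_civita_compat i :
  map_mx (d i) g = levi_civita i *m g + g *m (levi_civita i)^T.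
Proof.
have gS a b : g a b = g b a by rewrite -{1}g_sym mxE.
(* Lowering with [g] cancels [h] and leaves the Christoffel symbols of the first kind; adding the
   transpose keeps only [d i (g a b)], with the factor [half + half]. *)
have lower a b : (levi_civita i *m g) a b =
    half * (d i (g a b) + d a (g i b) - d b (g i a)).
  rewrite mxE; under eq_bigr do rewrite mxE -mulrA mulr_suml.
  rewrite -mulr_sumr exchange_big /=; congr (_ * _).
  pose t m := d i (g a m) + d a (g i m) - d m (g i a).
  transitivity ((\row_m t m *m (h *m g)) 0 b).
    rewrite mulmxA !mxE; under [RHS]eq_bigr do rewrite mxE mulr_suml.
    rewrite [RHS]exchange_big; apply: eq_bigr => m _; apply: eq_bigr => l _.
    rewrite mxE -/(t m) [h l m * _]mulrC; congr (_ * _ * _).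
    by rewrite -{1}h_sym mxE.
  by rewrite hg mulmx1 mxE.
have -> : g *m (levi_civita i)^T = (levi_civita i *m g)^T by rewrite trmx_mul g_sym.
apply/matrixP => a b; rewrite addmxE [(_ *m _)^T a b]mxE !lower [LHS]mxE.
by rewrite (gS b a) -[LHS]mul1r -half2; ring.
Qed.

End LeviCivita.

(** * Curvature, Bianchi identities and the divergence of the Ricci operator *)

Section DifferentialAlgebra.
Context {K : comPzRingType} {n : nat}.
Variable d : 'I_n -> {additive K -> K}.
Hypothesis dM : forall i a b, d i (a * b) = d i a * b + a * d i b.
Hypothesis dC : forall i j a, d i (d j a) = d j (d i a).
Hypothesis double_eq0 : forall a : K, a + a = 0 -> a = 0.

Local Notation D i M := (map_mx (d i) M).

Lemma map_mx_derivM i p q r (M : 'M[K]_(p, q)) (N : 'M[K]_(q, r)) :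
  D i (M *m N) = D i M *m N + M *m D i N.
Proof.
apply/matrixP => a b; rewrite !mxE raddf_sum -big_split /=.
by apply: eq_bigr => c _; rewrite dM !mxE.
Qed.

Lemma map_mx_derivC i j p q (M : 'M[K]_(p, q)) : D i (D j M) = D j (D i M).
Proof. by apply/matrixP => a b; rewrite !mxE dC. Qed.

Lemma deriv1 i : d i 1 = 0.
Proof.
have /eqP := dM i 1 1; rewrite !(mulr1, mul1r) -subr_eq0 opprD addrA subrr add0r.
by rewrite oppr_eq0 => /eqP.
Qed.

Lemma map_mx_deriv1 i m : D i (1%:M : 'M[K]_m) = 0.
Proof.
by apply/matrixP => a b; rewrite !mxE raddfMn deriv1 mul0rn.
Qed.

(* [A i k l] is the component along [e_l] of the covariant derivative of [e_k]
   in the direction [e_i]; a row [v] is differentiated as [D i v + v *m A i]. *)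
Variable A : 'I_n -> 'M[K]_n.

(** The commutator of the operators [v |-> D i v + v *m A i]. The quadratic terms come in reversed
    order because matrices act on rows from the right. *)
Definition curvature i j : 'M[K]_n :=
  D i (A j) - D j (A i) + A j *m A i - A i *m A j.

Definition ricci_trace : 'M[K]_n :=
  \matrix_(j, k) \sum_i curvature i j k i.

Lemma curvatureE i j k l : curvature i j k l =
  d i (A j k l) - d j (A i k l)
  + \sum_m (A j k m * A i m l - A i k m * A j m l).
Proof.
by rewrite /curvature !(addmxE, oppmxE) -addrA sumrB ![map_mx _ _ k l]mxE !mxE.
Qed.

Lemma curvatureC i j : curvature j i = - curvature i j.
Proof.
rewrite /curvature; apply/matrixP => a b.
by rewrite !(addmxE, oppmxE); ring.
Qed.

(** The Jacobi identity for these operators. Here [nabla] differentiates covariantly only the two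
    matrix indices: for a torsion-free connection the terms coming from the two form indices cancel
    in the cyclic sum. *)
Lemma second_bianchi i j m :
  let nabla a b c := D a (curvature b c) + curvature b c *m A a
                     - A a *m curvature b c in
  nabla m i j + nabla i j m + nabla j m i = 0.
Proof.
rewrite /curvature /=.
rewrite !(map_mxB, map_mxD) !map_mx_derivM.
rewrite !(mulmxDl, mulmxDr, mulmxBl, mulmxBr, mulmxN, mulNmx, mulmxA).
rewrite (map_mx_derivC m i) (map_mx_derivC m j) (map_mx_derivC i j).
by apply/matrixP => a b; rewrite !(addmxE, oppmxE) [RHS]mxE; ring.
Qed.

Variables g h : 'M[K]_n.
Hypothesis hg : h *m g = 1%:M.
Hypothesis gh : g *m h = 1%:M.
Hypothesis h_sym : h^T = h.
Hypothesis compat : forall i, D i g = A i *m g + g *m (A i)^T.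
Hypothesis torsion_free : forall i j l, A i j l = A j i l.

Lemma deriv_inverse_metric i : D i h = - (h *m A i + (A i)^T *m h).
Proof.
have := congr1 (fun M => D i M *m h) hg.
rewrite /= map_mx_derivM compat map_mx_deriv1 mul0mx mulmxDl -mulmxA gh mulmx1.
move/eqP; rewrite addr_eq0 => /eqP ->; congr (- _).
by rewrite mulmxDr mulmxDl !mulmxA -(mulmxA _ g) gh mulmx1 hg mul1mx.
Qed.

(** Two derivatives of [g] commute; expanded twice by [compat], their commutator is the action of
    the curvature on [g]. *)
Lemma curvature_metric_skew i j :
  curvature i j *m g + g *m (curvature i j)^T = 0.
Proof.
have := map_mx_derivC i j g; rewrite !compat !map_mxD !map_mx_derivM !compat.
move/eqP; rewrite -subr_eq0 => /eqP <-.
rewrite /curvature !(raddfB, raddfD) /= !trmx_mul -!map_trmx.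
rewrite !(mulmxDl, mulmxDr, mulmxBl, mulmxBr, mulmxN, mulNmx, mulmxA).
by apply/matrixP => a b; rewrite !(addmxE, oppmxE); ring.
Qed.

(* the last index of [curvature i j] is already contravariant *)
Definition raised_curvature i j : 'M[K]_n := h *m curvature i j.

Local Notation Q := raised_curvature.

Lemma raised_curvatureC i j : Q j i = - Q i j.
Proof. by rewrite /raised_curvature curvatureC mulmxN. Qed.

Lemma raised_curvature_tr i j : (Q i j)^T = - Q i j.
Proof.
apply/eqP; rewrite -addr_eq0 addrC; apply/eqP.
have := congr1 (fun M => h *m M *m h) (curvature_metric_skew i j).
rewrite /= mulmx0 mul0mx mulmxDr mulmxDl !mulmxA hg mul1mx -!mulmxA gh mulmx1.
by rewrite /raised_curvature trmx_mul h_sym.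
Qed.

Lemma raised_curvature_skew i j a b : Q i j a b = - Q i j b a.
Proof. by rewrite -oppmxE -raised_curvature_tr [RHS]mxE. Qed.

(** With the second index raised, the trace is the scalar curvature, and [k *m W] is the vector
    field Ric(k)^#. *)
Definition ricci_operator : 'M[K]_n := ricci_trace *m h.

Local Notation W := ricci_operator.

Lemma ricci_operatorE j l : W j l = \sum_i Q i j l i.
Proof.
rewrite mxE; under eq_bigr do rewrite !mxE mulr_suml.
rewrite exchange_big; apply: eq_bigr => i _; rewrite mxE; apply: eq_bigr => k _.
by rewrite mulrC -{1}h_sym mxE.
Qed.

(** The inverse metric is parallel, so raising an index commutes with [nabla]. *)
Lemma second_bianchi_raised i j m :
  let nabla a b c := D a (Q b c) + (A a)^T *m Q b c + Q b c *m A a in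
  nabla m i j + nabla i j m + nabla j m i = 0.
Proof.
move=> nabla.
have nablaE a b c : nabla a b c =
    h *m (D a (curvature b c) + curvature b c *m A a - A a *m curvature b c).
  rewrite /nabla /raised_curvature map_mx_derivM deriv_inverse_metric.
  rewrite !(mulmxDl, mulmxDr, mulmxBl, mulmxBr, mulmxN, mulNmx, mulmxA).
  by apply/matrixP => ? ?; rewrite !(addmxE, oppmxE); ring.
by rewrite !nablaE -!mulmxDr; have := second_bianchi i j m => /= ->; rewrite mulmx0.
Qed.

(** This is dS = 2 div Ric. The connection term for the lower index of [W] is
    [\sum_i (A i *m W) m i], which equals [\tr (A m *m W)] by torsion-freeness and has been moved to
    the left. The proof sums the entries [(j, i)] of the Bianchi identity over [i] and [j]: one term
    gives the left side, and each of the other two gives minus the divergence. *)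
Lemma contracted_bianchi m :
  d m (\tr W) + \tr (A m *m W) *+ 2 = (\sum_i (D i W + W *m A i) m i) *+ 2.
Proof.
pose nabla a b c := D a (Q b c) + (A a)^T *m Q b c + Q b c *m A a.
have trQ i p : \sum_j Q i j j p = W i p.
  rewrite ricci_operatorE; apply: eq_bigr => j _.
  by rewrite raised_curvatureC oppmxE -raised_curvature_skew.
have trQ' i p : \sum_j Q j i j p = - W i p.
  rewrite -trQ -sumrN; apply: eq_bigr => j _.
  by rewrite [in RHS]raised_curvatureC oppmxE opprK.
have first_term : \sum_i \sum_j nabla m i j j i = d m (\tr W) + \tr (A m *m W) *+ 2.
  rewrite /nabla; under eq_bigr do under eq_bigr do rewrite !addmxE.
  under eq_bigr do rewrite !big_split /=.
  rewrite !big_split /= -addrA mulr2n; congr (_ + (_ + _)).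
  - rewrite exchange_big raddf_sum /=; apply: eq_bigr => j _.
    by rewrite ricci_operatorE raddf_sum; apply: eq_bigr => i _; rewrite mxE.
  - rewrite exchange_big mxtrace_mulC /=; apply: eq_bigr => j _; rewrite mxE.
    under eq_bigr do rewrite mxE.
    rewrite exchange_big; apply: eq_bigr => p _; rewrite ricci_operatorE mulr_suml.
    by apply: eq_bigr => i _; rewrite mxE mulrC.
  - rewrite mxtrace_mulC; apply: eq_bigr => i _; rewrite mxE.
    under eq_bigr do rewrite mxE.
    by rewrite exchange_big; apply: eq_bigr => p _; rewrite -mulr_suml trQ.
have second_term : \sum_i \sum_j nabla i j m j i = - \sum_i (D i W + W *m A i) m i.
  rewrite /nabla; under eq_bigr do under eq_bigr do rewrite !addmxE.
  under eq_bigr do rewrite !big_split /=.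
  rewrite !big_split /= -sumrN.
  under [RHS]eq_bigr do rewrite !addmxE opprD.
  rewrite big_split /=; congr (_ + _); last first.
    apply: eq_bigr => i _; rewrite mxE -sumrN.
    under eq_bigr do rewrite mxE.
    by rewrite exchange_big; apply: eq_bigr => p _; rewrite -mulr_suml trQ' mulNr.
  rewrite [X in _ + X](_ : _ = 0) ?addr0.
    apply: eq_bigr => i _; rewrite mxE -raddfN -trQ' raddf_sum.
    by apply: eq_bigr => j _; rewrite mxE.
  (* [A i p j] is symmetric in [i] and [p], whereas [Q j m p i] is skew in them. *)
  set X := \sum_i _; suff XN : X = - X by apply: double_eq0; rewrite {1}XN addNr.
  have -> : X = \sum_j \sum_i \sum_p A i p j * Q j m p i.
    rewrite /X exchange_big; apply: eq_bigr => j _; apply: eq_bigr => i _.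
    by rewrite mxE; apply: eq_bigr => p _; rewrite mxE.
  rewrite -sumrN; apply: eq_bigr => j _; rewrite [LHS]exchange_big -sumrN.
  apply: eq_bigr => p _; rewrite -sumrN; apply: eq_bigr => i _.
  by rewrite torsion_free raised_curvature_skew mulrN.
(* After renaming the summation indices, skewness in the form pair and skewness in the matrix pair
   contribute one sign each, and the signs cancel. *)
have third_term : \sum_i \sum_j nabla j m i j i = \sum_i \sum_j nabla i j m j i.
  have nablaC a b c : nabla a c b = - nabla a b c.
    by rewrite /nabla raised_curvatureC map_mxN mulmxN mulNmx !opprD.
  have nabla_tr a b c : (nabla a b c)^T = - nabla a b c.
    have := raised_curvature_tr b c; rewrite /nabla; move: (Q b c) => q qT.
    rewrite !raddfD /= !trmx_mul map_trmx qT trmxK map_mxN mulmxN mulNmx.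
    by rewrite -!opprD addrAC.
  rewrite exchange_big; apply: eq_bigr => i _; apply: eq_bigr => j _.
  by rewrite nablaC -nabla_tr [LHS]mxE.
have bianchi i j : nabla m i j + nabla i j m + nabla j m i = 0.
  exact: second_bianchi_raised.
clearbody nabla.
have : \sum_i \sum_j (nabla m i j + nabla i j m + nabla j m i) j i = 0.
  by apply: big1 => i _; apply: big1 => j _; rewrite bianchi mxE.
under eq_bigr do under eq_bigr do rewrite !addmxE.
under eq_bigr do rewrite !big_split /=.
rewrite !big_split /= third_term second_term first_term => /eqP.
by rewrite -addrA -opprD subr_eq0 -mulr2n => /eqP.
Qed.

Variable k : 'rV[K]_n.

Definition covariant_derivative : 'M[K]_n :=
  \matrix_(i, l) (D i k + k *m A i) 0 l.

Local Notation B := covariant_derivative.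

(** [compat] turns the derivative of [g] along [k] into connection terms, and [torsion_free]
    exchanges the direction of differentiation with the frame index; these are then the connection
    terms of [B]. *)
Lemma lie_derivative_metric i j :
  \sum_l (k 0 l * d l (g i j) + g l j * d i (k 0 l) + g i l * d j (k 0 l)) =
  (B *m g + g *m B^T) i j.
Proof.
have -> : (B *m g + g *m B^T) i j =
  \sum_l d i (k 0 l) * g l j + \sum_l g i l * d j (k 0 l)
   + (k *m A i *m g) 0 j + (g *m (A j)^T *m k^T) i 0.
  have BE a l : B a l = d a (k 0 l) + (k *m A a) 0 l.
    by rewrite mxE addmxE [D a k _ _]mxE.
  rewrite -(mulmxA g) -trmx_mul addmxE [X in X + _ = _]mxE [X in _ + X = _]mxE.
  under eq_bigr do rewrite BE mulrDl.
  under [X in _ + X = _]eq_bigr do rewrite [B^T _ _]mxE BE mulrDr.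
  rewrite !big_split /= [in RHS]mxE [X in _ = _ + X]mxE.
  under [X in _ = _ + X]eq_bigr do rewrite [(k *m _)^T _ _]mxE.
  by ring.
rewrite !big_split /=.
have -> : \sum_l k 0 l * d l (g i j) = (k *m A i *m g) 0 j + (g *m (A j)^T *m k^T) i 0.
  rewrite -mulmxA 2![in RHS]mxE -big_split /=; apply: eq_bigr => l _.
  have -> : d l (g i j) = D l g i j by rewrite mxE.
  rewrite compat [k^T _ _]mxE [_ * k _ _]mulrC -mulrDr addmxE; congr (_ * (_ + _)).
    by rewrite !mxE; apply: eq_bigr => p _; rewrite torsion_free.
  by rewrite !mxE; apply: eq_bigr => p _; rewrite !mxE torsion_free.
under [X in _ + X + _]eq_bigr do rewrite mulrC.
by ring.
Qed.

(** Both sides are 2 g(nabla_k k, k), by compatibility of the connection with the metric. *)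
Lemma derivative_square_norm :
  \sum_l k 0 l * d l ((k *m g *m k^T) 0 0) = (k *m (B *m g + g *m B^T) *m k^T) 0 0.
Proof.
have rowB l : row l B = D l k + k *m A l.
  by apply/rowP => i; rewrite [LHS]mxE [LHS]mxE.
have dE l : d l ((k *m g *m k^T) 0 0) =
    (row l B *m (g *m k^T)) 0 0 + (k *m g *m (row l B)^T) 0 0.
  transitivity (D l (k *m g *m k^T) 0 0); first by rewrite [RHS]mxE.
  have rowBT : (row l B)^T = (D l k)^T + (A l)^T *m k^T.
    by rewrite rowB linearD /= trmx_mul.
  rewrite rowBT rowB !map_mx_derivM compat -map_trmx.
  rewrite !(mulmxDl, mulmxDr, mulmxA) !addmxE; ring.
under eq_bigr do rewrite dE mulrDr.
rewrite big_split /= mulmxDr mulmxDl addmxE; congr (_ + _).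
  rewrite -!mulmxA [RHS]mxE; apply: eq_bigr => l _; congr (_ * _).
  by rewrite -row_mul [LHS]mxE.
rewrite [k *m (g *m _)]mulmxA [RHS]mxE; apply: eq_bigr => l _.
by rewrite tr_row colE mulmxA -colE [col _ _ _ _]mxE mulrC [k^T _ _]mxE.
Qed.

(* the divergence of the vanishing vector field [k *m W] *)
Lemma trace_covariant_ricci0 :
  k *m ricci_trace = 0 -> (forall i, d i (\tr W) = 0) -> \tr (B *m W) = 0.
Proof.
move=> k_ker dS.
have kW : k *m W = 0 by rewrite /ricci_operator mulmxA k_ker mul0mx.
(* The product rule applied to [k *m W = 0]. *)
have BW i l : (B *m W) i l = - (k *m (D i W - A i *m W)) 0 l.
  have /matrixP/(_ 0 l) := congr1 (fun M => D i M) kW.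
  rewrite map_mx_derivM map_mx0 [RHS]mxE => DkW.
  have -> : (B *m W) i l = ((D i k + k *m A i) *m W) 0 l.
    by rewrite !mxE; apply: eq_bigr => p _; rewrite mxE.
  rewrite mulmxDl mulmxBr (mulmxA k (A i)); move: DkW; rewrite !(addmxE, oppmxE).
  by move=> /eqP; rewrite addr_eq0 => /eqP ->; ring.
(* The contracted Bianchi identity for constant scalar curvature, halved. The terms [W *m A i] on
   the right disappear at the end, on contraction with [k], because [k *m W = 0]. *)
have divW : forall m, \sum_i (D i W - A i *m W) m i = - \sum_i (W *m A i) m i.
  move=> m; apply/eqP; rewrite -subr_eq0 opprK -big_split /=; apply/eqP.
  apply: double_eq0; have := contracted_bianchi m; rewrite dS add0r.
  have -> : \tr (A m *m W) = \sum_i (A i *m W) m i.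
    by apply: eq_bigr => i _; rewrite !mxE; apply: eq_bigr => p _; rewrite torsion_free.
  move/eqP; rewrite eq_sym -subr_eq0 -mulrnBl => /eqP twice0.
  rewrite -[RHS]twice0 -mulr2n; congr (_ *+ 2).
  rewrite -sumrB; apply: eq_bigr => i _; rewrite !(addmxE, oppmxE); ring.
rewrite /mxtrace; under eq_bigr do rewrite BW.
rewrite sumrN; apply/eqP; rewrite oppr_eq0; apply/eqP.
under eq_bigr do rewrite mxE.
rewrite exchange_big /=; under eq_bigr do rewrite -mulr_sumr divW mulrN.
rewrite sumrN; apply/eqP; rewrite oppr_eq0; apply/eqP.
under eq_bigr do rewrite mulr_sumr.
rewrite exchange_big /=; apply: big1 => i _.
transitivity ((k *m (W *m A i)) 0 i); first by rewrite [RHS]mxE.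
by rewrite mulmxA kW mul0mx mxE.
Qed.

End DifferentialAlgebra.

(** * Positive definite matrices and double bivectors *)

Definition posdef (R : rcfType) n (M : 'M[R]_n) :=
  forall v : 'rV[R]_n, v != 0 -> 0 < (v *m M *m v^T) 0 0.

Lemma posdef_unit (R : rcfType) n (M : 'M[R]_n) : posdef M -> M \in unitmx.
Proof.
move=> Mpos; rewrite -row_free_unit -kermx_eq0; apply/rowV0P => v /sub_kermxP vM.
by apply/eqP/negPn/negP => /Mpos; rewrite vM mul0mx mxE ltxx.
Qed.

Lemma posdef_inv (R : rcfType) n (M : 'M[R]_n) :
  M^T = M -> posdef M -> posdef (invmx M).
Proof.
move=> Msym Mpos v v0; have Mu := posdef_unit Mpos.
have := Mpos (v *m invmx M); rewrite -!mulmxA mulKmx // trmx_mul trmx_inv Msym.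
by apply; apply: contraNneq v0 => v0; rewrite -(mulmxKV Mu v) v0 mul0mx.
Qed.

(** Cholesky factorization: the first coordinate is split off, and the induction hypothesis applies
    to the Schur complement of the corner [a]. *)
Lemma posdef_gram (R : rcfType) n (M : 'M[R]_n) : M^T = M -> posdef M ->
  exists U : 'M[R]_n, M = U^T *m U.
Proof.
elim: n M => [|n IHn] M Msym Mpos; first by exists 0; apply/matrixP => - [].
rewrite -[n.+1]/(1 + n)%N in M Msym Mpos *.
pose a := M 0 0; pose b := ursubmx M; pose C := drsubmx M.
have MC : M = block_mx a%:M b b^T C.
  rewrite -[LHS]submxK [ulsubmx M]mx11_scalar; congr block_mx.
    by rewrite /a !mxE; congr (M _ _)%:M; apply: val_inj.
  by rewrite -{1}Msym -trmx_ursub.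
have a_gt0 : 0 < a.
  have := Mpos (row_mx 1%:M 0); rewrite MC mul_row_block !mul1mx !mul0mx !addr0.
  rewrite tr_row_mx mul_row_col trmx1 trmx0 mulmx1 mulmx0 addr0 mxE eqxx mulr1n.
  apply; apply/eqP => /(congr1 lsubmx); rewrite row_mxKl linear0 => /matrixP/(_ 0 0).
  by rewrite !mxE eqxx => /eqP; rewrite oner_eq0.
have a_neq0 : a != 0 by rewrite gt_eqF.
have Csym : C^T = C by rewrite /C trmx_drsub Msym.
have [||U' CU] := IHn (C - a^-1 *: (b^T *m b)).
- by rewrite linearB /= linearZ /= trmx_mul trmxK Csym.
- move=> v v0.
  (* For fixed [v], this first coordinate minimizes the quadratic form of [M]; the minimum is the
     value of the Schur complement at [v]. *)
  pose s := (v *m b^T) 0 0; pose w := row_mx (- (a^-1 * s))%:M v.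
  have := Mpos w; rewrite MC mul_row_block tr_row_mx mul_row_col.
  have vb : v *m b^T = s%:M by rewrite [LHS]mx11_scalar.
  have bv : b *m v^T = s%:M by rewrite -[LHS]trmxK trmx_mul trmxK vb tr_scalar_mx.
  have w0 : w != 0.
    by apply: contraNneq v0 => /(congr1 rsubmx); rewrite row_mxKr linear0 => ->.
  move=> /(_ w0); rewrite vb (mulmxDl _ _ v^T) -(mulmxA _ b v^T) bv.
  rewrite mulmxBr mulmxBl -scalemxAr -scalemxAl (mulmxA v b^T) vb -(mulmxA _ b) bv.
  move: (v *m C *m v^T) => z; rewrite tr_scalar_mx -!scalar_mxM -raddfD -scalar_mxM.
  rewrite !mxE /= !mulr1n; congr (_ < _); by field.
exists (block_mx (Num.sqrt a)%:M ((Num.sqrt a)^-1 *: b) 0 U').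
rewrite MC tr_block_mx mulmx_block !trmx0 !mul0mx !mulmx0 !addr0 tr_scalar_mx.
have sa : Num.sqrt a * Num.sqrt a = a by rewrite -expr2 sqr_sqrtr // ltW.
have sa0 : Num.sqrt a != 0 by rewrite sqrtr_eq0 -ltNge.
have bZ : ((Num.sqrt a)^-1 *: b)^T = (Num.sqrt a)^-1 *: b^T by rewrite linearZ.
rewrite bZ -scalar_mxM sa -CU mul_scalar_mx mul_mx_scalar !scalerA divff // !scale1r.
by rewrite -scalemxAl -scalemxAr scalerA -invfM sa addrCA subrr addr0.
Qed.

(** Writing the last [H] as [U^T *m U] turns the trace into the sum of the values of the form [H] at
    the rows of [U *m T]. Each value is nonnegative, so each vanishes and [U *m T = 0]. *)
Lemma posdef_trace_sqr_eq0 (R : rcfType) n (T H : 'M[R]_n) :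
  T^T = T -> H^T = H -> posdef H -> \tr (T *m H *m T *m H) = 0 -> T = 0.
Proof.
move=> Tsym Hsym Hpos; have [U HU] := posdef_gram Hsym Hpos.
rewrite {2}HU mulmxA mxtrace_mulC !mulmxA => /eqP tr0.
have quadE i : (U *m T *m H *m T *m U^T) i i =
    (row i (U *m T) *m H *m (row i (U *m T))^T) 0 0.
  rewrite tr_row trmx_mul Tsym -row_mul -(mulmxA _ T).
  rewrite [LHS]mxE [RHS]mxE; apply: eq_bigr => p _.
  by rewrite [row _ _ _ _]mxE [col _ _ _ _]mxE.
have quad_ge0 i : 0 <= (U *m T *m H *m T *m U^T) i i.
  rewrite quadE; have [->|/Hpos/ltW //] := eqVneq (row i (U *m T)) 0.
  by rewrite !mul0mx mxE.
have UT : U *m T = 0.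
  apply/row_matrixP => i; rewrite row0; apply/eqP/negPn/negP => /Hpos.
  rewrite -quadE; move: tr0; rewrite psumr_eq0 // => /allP/(_ i).
  by rewrite mem_index_enum => /(_ isT)/eqP ->; rewrite ltxx.
by rewrite -(mulKmx (posdef_unit Hpos) T) HU -mulmxA UT !mulmx0.
Qed.

(** In dimension 3 bivectors form a 3-dimensional space, so skewness leaves nine components, as many
    as there are trace equations. An equation with [j] different from [l] has a single surviving
    term; the three with [j = l] make the pairwise sums of the remaining three components vanish. *)
Lemma double_bivector_trace_eq0 (R : realFieldType) (Q : 'I_3 -> 'I_3 -> 'M[R]_3) :
  (forall i j a b, Q j i a b = - Q i j a b) ->
  (forall i j a b, Q i j b a = - Q i j a b) ->
  (forall j l, \sum_i Q i j l i = 0) ->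
  forall i j, Q i j = 0.
Proof.
move=> QC QT Q0.
pose o0 : 'I_3 := ord0; pose o1 : 'I_3 := lift ord0 ord0.
pose o2 : 'I_3 := lift ord0 (lift ord0 ord0).
have I3 (i : 'I_3) : [\/ i = o0, i = o1 | i = o2].
  by case: i => [[|[|[|i]]] lti] //;
    [constructor 1 | constructor 2 | constructor 3]; apply: val_inj.
have S3 j l : Q o0 j l o0 + Q o1 j l o1 + Q o2 j l o2 = 0.
  by rewrite -[RHS](Q0 j l) !big_ord_recl big_ord0 addr0 addrA.
have Qii i a b : Q i i a b = 0 by have := QC i i a b; lra.
have Qaa i j a : Q i j a a = 0 by have := QT i j a a; lra.
have QC01 := QC o0 o1; have QC02 := QC o0 o2; have QC12 := QC o1 o2.
have QT01 i j := QT i j o0 o1; have QT02 i j := QT i j o0 o2.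
have QT12 i j := QT i j o1 o2.
pose QE := (QC01, QC02, QC12, QT01, QT02, QT12, Qii, Qaa).
have := (S3 o0 o0, S3 o0 o1, S3 o0 o2, (S3 o1 o0, S3 o1 o1, S3 o1 o2),
         (S3 o2 o0, S3 o2 o1, S3 o2 o2)).
rewrite !QE => -[[[[e1 e2] e3] [[e4 e5] e6]] [[e7 e8] e9]].
have z : (Q o0 o1 o0 o1 = 0) * (Q o0 o1 o0 o2 = 0) * (Q o0 o1 o1 o2 = 0) *
  (Q o0 o2 o0 o1 = 0) * (Q o0 o2 o0 o2 = 0) * (Q o0 o2 o1 o2 = 0) *
  (Q o1 o2 o0 o1 = 0) * (Q o1 o2 o0 o2 = 0) * (Q o1 o2 o1 o2 = 0).
  by do !split; lra.
move=> i j; apply/matrixP => a b; rewrite mxE.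
by case: (I3 i) => ->; case: (I3 j) => ->; case: (I3 a) => ->;
  case: (I3 b) => ->; rewrite !(QE, z, oppr0).
Qed.

(** * Directional derivatives *)

Section DirectionalDerivatives.
Context {R : realType} {V : normedModType R}.
Implicit Types (f : V -> R) (x v w : V).

Lemma is_derive_line f x v (s : R) : derivable f (s *: v + x) v ->
  is_derive s 1 (fun t : R => f (t *: v + x)) ('D_v f (s *: v + x)).
Proof.
have quotE : (fun h : R => h^-1 *:
      (((fun t : R => f (t *: v + x)) \o shift s) (h *: 1) - f (s *: v + x))) =
    (fun h : R => h^-1 *: ((f \o shift (s *: v + x)) (h *: v) - f (s *: v + x))).
  by apply/funext => h /=; rewrite [h *: 1]mulr1 scalerDl addrA.
by move=> df; apply: DeriveDef; rewrite /derivable /derive quotE.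
Qed.

Lemma derive_translate f x v w :
  'D_v (fun y => f (y + w)) x = 'D_v f (x + w).
Proof.
rewrite /derive (_ : (fun h => _) = (fun h : R =>
  h^-1 *: ((f \o shift (x + w)) (h *: v) - f (x + w)))) //.
by apply/funext => h /=; rewrite addrA.
Qed.

Lemma derivable_translate f x v w :
  derivable f (x + w) v -> derivable (fun y => f (y + w)) x v.
Proof.
rewrite /derivable (_ : (fun h => _) = (fun h : R =>
  h^-1 *: (((fun y => f (y + w)) \o shift x) (h *: v) - f (x + w)))) //.
by apply/funext => h /=; rewrite addrA.
Qed.

Lemma MVT_line f x v (t : R) : 0 < t ->
  (forall s, 0 <= s <= t -> derivable f (s *: v + x) v) ->
  exists2 c, 0 < c < t & f (t *: v + x) - f x = t * 'D_v f (c *: v + x).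
Proof.
move=> t_gt0 df.
have [||c] := @MVT R (fun s => f (s *: v + x)) (fun s => 'D_v f (s *: v + x)) 0 t t_gt0.
- move=> s; rewrite in_itv /= => /andP[s0 st].
  by apply: is_derive_line; apply: df; rewrite !ltW.
- apply: derivable_within_continuous => s; rewrite in_itv /= => /df dfs.
  by have [] := is_derive_line dfs.
rewrite in_itv /= => c0t; rewrite scale0r add0r subr0 mulrC => fE.
by exists c.
Qed.

Lemma derive_eq0_at_max f x v : derivable f x v ->
  (\forall y \near x, f y <= f x) ->
  (\forall y \near x, derivable f y v) -> 'D_v f x = 0.
Proof.
move=> dfx fmax dnear.
have line_cvg : (fun s : R => s *: v + x) @ (0 : R) --> x.
  have /differentiable_continuous : differentiable (fun s : R => s *: v + x) 0 by [].
  by rewrite /prop_for /continuous_at /= scale0r add0r.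
have /nbhs_ballP[r /= r0 rP] :
    \forall s \near (0 : R), f (s *: v + x) <= f x /\ derivable f (s *: v + x) v.
  exact: (line_cvg _ (filterI fmax dnear)).
have inball s : s \in `]- r, r[ -> ball (0 : R) r s.
  by rewrite in_itv /= -ball_normE /= sub0r normrN ltr_norml.
have rr : - r <= r by rewrite -subr_ge0 opprK addr_ge0 ?ltW.
case: (@derive1_at_max R (fun s => f (s *: v + x)) (- r) r 0 rr).
- by move=> s /inball /rP [_ dfs]; case: (is_derive_line dfs).
- by rewrite in_itv /= oppr_lt0 r0.
- by move=> s /inball /rP[]; rewrite scale0r add0r.
move=> _ D0.
have := @is_derive_line f x v 0; rewrite scale0r add0r => /(_ dfx) [_ <-].
exact: D0.
Qed.

(** The mean value theorem is used twice: along [v] for the increment [f (y + t *: w) - f y], then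
    along [w] for ['D_v f]. *)
Lemma mixed_difference f x v w (t : R) : 0 < t ->
  (forall a b, 0 <= a <= t -> 0 <= b <= t ->
     derivable f (a *: v + (b *: w + x)) v /\
     derivable ('D_v f) (a *: v + (b *: w + x)) w) ->
  exists a b : R, [/\ 0 <= a <= t, 0 <= b <= t &
    f (t *: v + (t *: w + x)) - f (t *: v + x) - (f (t *: w + x) - f x)
     = t ^+ 2 * 'D_w ('D_v f) (a *: v + (b *: w + x))].
Proof.
move=> t0 df.
have t0t : 0 <= t <= t by rewrite lexx ltW.
have z0t : (0 : R) <= 0 <= t by apply/andP; split; [exact: lexx | exact: ltW].
have [|a a0t aE] := @MVT_line (fun y => f (y + t *: w) - f y) x v t t0.
  move=> s s0t; apply: derivableB.
    apply: derivable_translate; rewrite -addrA (addrC x).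
    exact: (df s t s0t t0t).1.
  by have := (df s 0 s0t z0t).1; rewrite scale0r add0r.
have {}a0t : 0 <= a <= t by case/andP: a0t => ? ?; rewrite !ltW.
have [|b b0t bE] := @MVT_line ('D_v f) (a *: v + x) w t t0.
  by move=> s s0t; rewrite addrCA; exact: (df a s a0t s0t).2.
have {}b0t : 0 <= b <= t by case/andP: b0t => ? ?; rewrite !ltW.
exists a, b; split; [exact: a0t | exact: b0t |].
move: aE; rewrite -(addrA _ x (t *: w)) (addrC x) => ->.
rewrite -[fun y => _]/((fun y => f (y + t *: w)) - f) deriveB.
- rewrite derive_translate expr2 -mulrA; congr (_ * _).
  by rewrite addrCA -bE [t *: w + _]addrC.
- apply: derivable_translate; rewrite -addrA (addrC x).
  exact: (df a t a0t t0t).1.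
- by have := (df a 0 a0t z0t).1; rewrite scale0r add0r.
Qed.

(** The second difference is symmetric in [v] and [w], so the two mixed derivatives agree at some
    pair of points arbitrarily close to [x]; continuity brings the equality to [x]. *)
Lemma deriveC f x v w :
  (\forall y \near x, [/\ derivable f y v, derivable f y w,
     derivable ('D_v f) y w & derivable ('D_w f) y v]) ->
  {for x, continuous ('D_w ('D_v f))} -> {for x, continuous ('D_v ('D_w f))} ->
  'D_w ('D_v f) x = 'D_v ('D_w f) x.
Proof.
move=> dnear cwv cvw; apply/eqP/negPn/negP => neq.
set F := 'D_w ('D_v f) in cwv neq *; set G := 'D_v ('D_w f) in cvw neq *.
pose e := `|F x - G x| / 2.
have e0 : 0 < e by rewrite divr_gt0 // normr_gt0 subr_eq0.
have /nbhs_ballP[r /= r0 rP] : \forall y \near x,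
   [/\ [/\ derivable f y v, derivable f y w,
     derivable ('D_v f) y w & derivable ('D_w f) y v],
     `|F x - F y| < e & `|G x - G y| < e].
  have cF : \forall y \near x, `|F x - F y| < e by move/cvgrPdist_lt : cwv => /(_ e e0).
  have cG : \forall y \near x, `|G x - G y| < e by move/cvgrPdist_lt : cvw => /(_ e e0).
  by apply: filterS3 dnear cF cG => y Hd HF HG; exact: And3 Hd HF HG.
(* Small enough to keep the whole parallelogram inside the ball of radius [r]; the summand 1 keeps
   the denominator positive when both vectors vanish. *)
pose t := r / (`|v| + `|w| + 1).
have den : 0 < `|v| + `|w| + 1 by rewrite ltr_wpDl // addr_ge0.
have t0 : 0 < t by rewrite divr_gt0.
have inball a b : 0 <= a <= t -> 0 <= b <= t -> ball x r (a *: v + (b *: w + x)).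
  move=> /andP[a0 at_] /andP[b0 bt]; rewrite -ball_normE /=.
  rewrite addrA opprD addrCA subrr addr0 normrN.
  apply: (@le_lt_trans _ _ (t * (`|v| + `|w|))).
    rewrite mulrDr; apply: (le_trans (ler_normD _ _)).
    by rewrite !normrZ !ger0_norm // lerD // ler_wpM2r.
  rewrite /t -mulrA mulrC -ltr_pdivlMr // divff ?gt_eqF //.
  by rewrite mulrC ltr_pdivrMr // mul1r ltrDl.
have [a [b [a0t b0t abE]]] : exists a b : R, [/\ 0 <= a <= t, 0 <= b <= t &
    f (t *: v + (t *: w + x)) - f (t *: v + x) - (f (t *: w + x) - f x)
     = t ^+ 2 * F (a *: v + (b *: w + x))].
  apply: (mixed_difference t0) => a b ha hb.
  by have [[dv _ dwv _] _ _] := rP _ (inball _ _ ha hb); exact: conj dv dwv.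
have [a' [b' [a0t' b0t' abE']]] : exists a b : R, [/\ 0 <= a <= t, 0 <= b <= t &
    f (t *: w + (t *: v + x)) - f (t *: w + x) - (f (t *: v + x) - f x)
     = t ^+ 2 * G (a *: w + (b *: v + x))].
  apply: (mixed_difference t0) => a' b' ha hb; rewrite addrCA.
  by have [[_ dw _ dvw] _ _] := rP _ (inball _ _ hb ha); exact: conj dw dvw.
clearbody F G; have [_ Fe _] := rP _ (inball _ _ a0t b0t).
have [_ _] := rP _ (inball _ _ b0t' a0t'); rewrite addrCA => Ge.
have FG : F (a *: v + (b *: w + x)) = G (a' *: w + (b' *: v + x)).
  apply: (mulfI (_ : t ^+ 2 != 0)); first by rewrite expf_neq0 // gt_eqF.
  have swap (X P Q Z : R) : X - P - (Q - Z) = X - Q - (P - Z) by ring.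
  by rewrite -abE -abE' (addrCA (t *: w)); exact: swap.
have : `|F x - G x| < e + e.
  rewrite -(subrKA (F (a *: v + (b *: w + x)))) {2}FG.
  by rewrite (le_lt_trans (ler_normD _ _)) // ltrD // distrC.
by rewrite /e -splitr ltxx.
Qed.

End DirectionalDerivatives.

(** * Closure properties of smooth functions *)

Section SmoothClosure.
Context {R : realType} {n : nat}.
Variable A : set 'rV[R]_n.
Hypothesis A_open : open A.
Implicit Types (f g : 'rV[R]_n -> R).

Lemma near_open f g x : A x -> (forall y, A y -> f y = g y) ->
  \forall y \near x, f y = g y.
Proof.
move=> Ax fg; apply: (@filterS _ _ _ A) => //.
by apply: open_nbhs_nbhs; split.
Qed.

Lemma partial_eq_on i f g x : A x -> (forall y, A y -> f y = g y) ->
  partial i f x = partial i g x.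
Proof. by move=> Ax fg; apply: near_eq_derive; exact: near_open. Qed.

(** A finite order gives products and inverses something to induct on: their derivatives are
    expressed by functions of one order less. Order 0 already includes the existence of the partial
    derivatives. *)
Definition Ck_on (k : nat) f : Prop :=
  forall (s : seq 'I_n) x, (size s <= k)%N -> A x ->
    {for x, continuous (foldr partial f s)} /\
    (forall i : 'I_n, derivable (foldr partial f s) x (delta_mx 0 i)).

Lemma smooth_onP f : smooth_on A f <-> forall k, Ck_on k f.
Proof.
split=> [fs k s x _ Ax|fs s x Ax]; first exact: fs.
exact: (fs (size s)).
Qed.

Lemma Ck_on0P f : Ck_on 0 f <-> forall x, A x ->
  {for x, continuous f} /\ (forall i, derivable f x (delta_mx 0 i)).
Proof.
split=> [fk x Ax|fk [|//] x _ Ax]; first exact: (fk [::]).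
exact: fk.
Qed.

(** [foldr] applies the last entry of the list first, so the innermost derivative is split off with
    [rcons]. *)
Lemma Ck_onS k f : Ck_on k.+1 f <-> Ck_on 0 f /\ forall i, Ck_on k (partial i f).
Proof.
split=> [fk|[f0 fk] s x].
  split=> [s x s0|i s x sk]; first by apply: fk; rewrite (leq_trans s0).
  by rewrite -foldr_rcons; apply: fk; rewrite size_rcons.
case/lastP: s => [_|s i]; first exact: (f0 [::]).
by rewrite size_rcons ltnS foldr_rcons; exact: fk.
Qed.

Lemma Ck_on_le k l f : (k <= l)%N -> Ck_on l f -> Ck_on k f.
Proof. by move=> kl fl s x sk; apply: fl; exact: leq_trans kl. Qed.

Lemma Ck_on_eq k f g : (forall x, A x -> f x = g x) -> Ck_on k f -> Ck_on k g.
Proof.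
move=> fg fk s x sk Ax.
have fgs : forall s y, A y -> foldr partial f s y = foldr partial g s y.
  elim=> [|i s' IH] y Ay /=; first exact: fg.
  exact: partial_eq_on.
have [fc fd] := fk s x sk Ax; split=> [|i].
  rewrite /prop_for /continuous_at -fgs //; apply: cvg_trans fc.
  exact: (near_eq_cvg (near_open Ax (fgs s))).
exact: (near_eq_derivable (near_open Ax (fgs s)) (fd i)).
Qed.

Lemma Ck_onD k f g : Ck_on k f -> Ck_on k g -> Ck_on k (fun x => f x + g x).
Proof.
have base f' g' : Ck_on 0 f' -> Ck_on 0 g' -> Ck_on 0 (fun x => f' x + g' x).
  move=> /Ck_on0P fk /Ck_on0P gk; apply/Ck_on0P => x Ax.
  have [fc fd] := fk x Ax; have [gc gd] := gk x Ax; split=> [|i].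
    exact: (cvgD fc gc).
  exact: (derivableD (fd i) (gd i)).
elim: k f g => [|k IH] f g; first exact: base.
move=> /Ck_onS[f0 fk] /Ck_onS[g0 gk]; apply/Ck_onS; split; first exact: base.
move=> i; apply: Ck_on_eq (IH _ _ (fk i) (gk i)) => x Ax.
have [_ fd] := (Ck_on0P f).1 f0 x Ax; have [_ gd] := (Ck_on0P g).1 g0 x Ax.
by rewrite /partial -(deriveD (fd i) (gd i)).
Qed.

Lemma Ck_onM k f g : Ck_on k f -> Ck_on k g -> Ck_on k (fun x => f x * g x).
Proof.
have base f' g' : Ck_on 0 f' -> Ck_on 0 g' -> Ck_on 0 (fun x => f' x * g' x).
  move=> /Ck_on0P fk /Ck_on0P gk; apply/Ck_on0P => x Ax.
  have [fc fd] := fk x Ax; have [gc gd] := gk x Ax; split=> [|i].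
    exact: (cvgM fc gc).
  exact: (derivableM (fd i) (gd i)).
elim: k f g => [|k IH] f g; first exact: base.
move=> fS gS; have [f0 fk] := (Ck_onS _ _).1 fS; have [g0 gk] := (Ck_onS _ _).1 gS.
apply/Ck_onS; split; first exact: base.
have fk' := Ck_on_le (leqnSn k) fS; have gk' := Ck_on_le (leqnSn k) gS.
move=> i; apply: Ck_on_eq (Ck_onD (IH _ _ fk' (gk i)) (IH _ _ gk' (fk i))) => x Ax.
have [_ fd] := (Ck_on0P f).1 f0 x Ax; have [_ gd] := (Ck_on0P g).1 g0 x Ax.
by rewrite /partial (deriveM (fd i) (gd i)).
Qed.

Lemma Ck_on_cst k (c : R) : Ck_on k (fun=> c).
Proof.
have base (c' : R) : Ck_on 0 (fun=> c').
  by apply/Ck_on0P => x _; split=> [|i]; [exact: cst_continuous | exact: derivable_cst].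
elim: k c => [|k IH] c; first exact: base.
apply/Ck_onS; split=> [|i]; first exact: base.
by apply: Ck_on_eq (IH 0) => x _; rewrite /partial (derive_cst c).
Qed.

(** The derivative of the inverse is minus its square times the derivative of [f], and the induction
    hypothesis covers this square at the lower order. *)
Lemma Ck_onV k f : (forall x, A x -> f x != 0) -> Ck_on k f ->
  Ck_on k (fun x => (f x)^-1).
Proof.
move=> f_neq0.
have base : Ck_on 0 f -> Ck_on 0 (fun x => (f x)^-1).
  move=> /Ck_on0P fk; apply/Ck_on0P => x Ax.
  have [fc fd] := fk x Ax; split=> [|i]; first exact: (cvgV (f_neq0 x Ax) fc).
  exact: (derivableV (f_neq0 x Ax) (fd i)).
elim: k => [|k IH]; first exact: base.
move=> fS; have [f0 fk] := (Ck_onS _ _).1 fS.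
apply/Ck_onS; split; first exact: base.
have fV := IH (Ck_on_le (leqnSn k) fS).
move=> i; have dV := Ck_onM (@Ck_on_cst k (-1)) (Ck_onM (Ck_onM fV fV) (fk i)).
apply: Ck_on_eq dV => x Ax.
have [_ fd] := (Ck_on0P f).1 f0 x Ax.
by rewrite /partial (deriveV (f_neq0 x Ax) (fd i)) expr2 invfM mulN1r scaleNr.
Qed.

Lemma smooth_on_eq f g : (forall x, A x -> f x = g x) ->
  smooth_on A f -> smooth_on A g.
Proof. by move=> fg /smooth_onP fs; apply/smooth_onP => k; apply: Ck_on_eq (fs k). Qed.

Lemma smooth_on_partial i f : smooth_on A f -> smooth_on A (partial i f).
Proof. by move=> fs s x Ax; rewrite -foldr_rcons; exact: fs. Qed.

Lemma smooth_onD f g : smooth_on A f -> smooth_on A g ->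
  smooth_on A (fun x => f x + g x).
Proof. by move=> /smooth_onP ? /smooth_onP ?; apply/smooth_onP => k; exact: Ck_onD. Qed.

Lemma smooth_onM f g : smooth_on A f -> smooth_on A g ->
  smooth_on A (fun x => f x * g x).
Proof. by move=> /smooth_onP ? /smooth_onP ?; apply/smooth_onP => k; exact: Ck_onM. Qed.

Lemma smooth_on_cst (c : R) : smooth_on A (fun=> c).
Proof. by apply/smooth_onP => k; exact: Ck_on_cst. Qed.

Lemma smooth_onN f : smooth_on A f -> smooth_on A (fun x => - f x).
Proof.
move=> fs; apply: smooth_on_eq (smooth_onM (smooth_on_cst (-1)) fs) => x _.
by rewrite mulN1r.
Qed.

Lemma smooth_onV f : (forall x, A x -> f x != 0) -> smooth_on A f ->
  smooth_on A (fun x => (f x)^-1).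
Proof. by move=> f0 /smooth_onP fs; apply/smooth_onP => k; exact: Ck_onV. Qed.

Lemma smooth_on_sum (I : Type) (r : seq I) (P : pred I) (F : I -> 'rV[R]_n -> R) :
  (forall i, smooth_on A (F i)) -> smooth_on A (fun x => \sum_(i <- r | P i) F i x).
Proof.
move=> Fs; elim: r => [|i r IH].
  by apply: smooth_on_eq (smooth_on_cst 0) => x _; rewrite big_nil.
case Pi: (P i).
  by apply: smooth_on_eq (smooth_onD (Fs i) IH) => x _; rewrite big_cons Pi.
by apply: smooth_on_eq IH => x _; rewrite big_cons Pi.
Qed.

Lemma smooth_on_prod (I : Type) (r : seq I) (P : pred I) (F : I -> 'rV[R]_n -> R) :
  (forall i, smooth_on A (F i)) -> smooth_on A (fun x => \prod_(i <- r | P i) F i x).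
Proof.
move=> Fs; elim: r => [|i r IH].
  by apply: smooth_on_eq (smooth_on_cst 1) => x _; rewrite big_nil.
case Pi: (P i).
  by apply: smooth_on_eq (smooth_onM (Fs i) IH) => x _; rewrite big_cons Pi.
by apply: smooth_on_eq IH => x _; rewrite big_cons Pi.
Qed.

Lemma smooth_on_det m (F : 'rV[R]_n -> 'M[R]_m) :
  smooth_mx_on A F -> smooth_on A (fun x => \det (F x)).
Proof.
move=> Fs; apply: smooth_on_sum => s; apply: smooth_onM; first exact: smooth_on_cst.
by apply: smooth_on_prod => i; exact: Fs.
Qed.

(** By Cramer's rule the entries are minors, polynomial in the entries of [F], divided by a nowhere
    vanishing determinant. *)
Lemma smooth_on_invmx m (F : 'rV[R]_n -> 'M[R]_m) :
  (forall x, A x -> F x \in unitmx) ->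
  smooth_mx_on A F -> smooth_mx_on A (fun x => invmx (F x)).
Proof.
move=> Fu Fs i j.
have detV : smooth_on A (fun x => (\det (F x))^-1).
  apply: smooth_onV; last exact: smooth_on_det.
  by move=> x /Fu; rewrite unitmxE unitfE.
have adj : smooth_on A (fun x => \adj (F x) i j).
  apply: (@smooth_on_eq (fun x => (-1) ^+ (j + i) * \det (row' j (col' i (F x))))).
    by move=> x _; rewrite mxE.
  apply: smooth_onM; first exact: smooth_on_cst.
  apply: smooth_on_det => a b.
  by apply: smooth_on_eq (Fs (lift j a) (lift i b)) => x _; rewrite !mxE.
apply: smooth_on_eq (smooth_onM detV adj) => x Ax.
by rewrite /invmx Fu // !mxE.
Qed.

Lemma partialC i j f x : smooth_on A f -> A x ->
  partial i (partial j f) x = partial j (partial i f) x.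
Proof.
move=> fs Ax; apply: deriveC; last 2 first.
- by have [] := fs [:: i; j] x Ax.
- by have [] := fs [:: j; i] x Ax.
apply: (@filterS _ _ _ A); last by apply: open_nbhs_nbhs; split.
move=> y Ay; split.
- exact: (fs [::] y Ay).2.
- exact: (fs [::] y Ay).2.
- exact: (fs [:: j] y Ay).2.
- exact: (fs [:: i] y Ay).2.
Qed.

End SmoothClosure.

(** * The ring of smooth functions on an open set *)

(* The values off [A] are set to 0, so that smooth functions on [A] are equal as
   soon as they agree on [A]. *)
Record smoothFun (R : realType) (n : nat) (A : set 'rV[R]_n)
    (A_open : open A) := SmoothFun {
  smooth_val :> 'rV[R]_n -> R;
  smooth_valP : smooth_on A smooth_val;
  smooth_val_off : forall x, ~ A x -> smooth_val x = 0
}.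

Section SmoothRing.
Context {R : realType} {n : nat} {A : set 'rV[R]_n} {A_open : open A}.
Implicit Types (f g h : smoothFun A_open).

Lemma smoothFun_ext f g : (forall x, A x -> f x = g x) -> f = g.
Proof.
case: f g => f fs f0 [g gs g0] /= fg.
have {}fg : f = g.
  by apply/funext => x; have [/fg //|nAx] := pselect (A x); rewrite f0 ?g0.
by subst g; congr (SmoothFun _); exact: Prop_irrelevance.
Qed.

HB.instance Definition _ := gen_eqMixin (smoothFun A_open).
HB.instance Definition _ := gen_choiceMixin (smoothFun A_open).

Definition smooth_restr (f : 'rV[R]_n -> R) x : R := if `[< A x >] then f x else 0.

Lemma smooth_restrE (f : 'rV[R]_n -> R) x : A x -> smooth_restr f x = f x.
Proof. by move=> Ax; rewrite /smooth_restr asboolT. Qed.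

Lemma smooth_restrP (f : 'rV[R]_n -> R) : smooth_on A f ->
  smooth_on A (smooth_restr f).
Proof.
by apply: smooth_on_eq => // x Ax; rewrite smooth_restrE.
Qed.

Lemma smooth_restr_off (f : 'rV[R]_n -> R) x : ~ A x -> smooth_restr f x = 0.
Proof. by move=> nAx; rewrite /smooth_restr asboolF. Qed.

Definition to_smooth (f : 'rV[R]_n -> R) (fs : smooth_on A f) : smoothFun A_open :=
  @SmoothFun _ _ _ A_open _ (smooth_restrP fs) (@smooth_restr_off f).

Arguments to_smooth : simpl never.

Lemma to_smoothE (f : 'rV[R]_n -> R) (fs : smooth_on A f) x :
  A x -> to_smooth fs x = f x.
Proof. exact: smooth_restrE. Qed.

Definition smooth_cst (c : R) := to_smooth (smooth_on_cst A_open c).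
Definition smooth_add f g :=
  to_smooth (smooth_onD A_open (smooth_valP f) (smooth_valP g)).
Definition smooth_mul f g :=
  to_smooth (smooth_onM A_open (smooth_valP f) (smooth_valP g)).
Definition smooth_opp f := to_smooth (smooth_onN A_open (smooth_valP f)).

Lemma smooth_addA : associative smooth_add.
Proof. by move=> f g h; apply: smoothFun_ext => x Ax; rewrite !to_smoothE // addrA. Qed.
Lemma smooth_addC : commutative smooth_add.
Proof. by move=> f g; apply: smoothFun_ext => x Ax; rewrite !to_smoothE // addrC. Qed.
Lemma smooth_add0 : left_id (smooth_cst 0) smooth_add.
Proof. by move=> f; apply: smoothFun_ext => x Ax; rewrite !to_smoothE // add0r. Qed.
Lemma smooth_addN : left_inverse (smooth_cst 0) smooth_opp smooth_add.
Proof. by move=> f; apply: smoothFun_ext => x Ax; rewrite !to_smoothE // addNr. Qed.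

HB.instance Definition _ := GRing.isZmodule.Build (smoothFun A_open)
  smooth_addA smooth_addC smooth_add0 smooth_addN.

Lemma smooth_mulA : associative smooth_mul.
Proof. by move=> f g h; apply: smoothFun_ext => x Ax; rewrite !to_smoothE // mulrA. Qed.
Lemma smooth_mulC : commutative smooth_mul.
Proof. by move=> f g; apply: smoothFun_ext => x Ax; rewrite !to_smoothE // mulrC. Qed.
Lemma smooth_mul1 : left_id (smooth_cst 1) smooth_mul.
Proof. by move=> f; apply: smoothFun_ext => x Ax; rewrite !to_smoothE // mul1r. Qed.
Lemma smooth_mulD : left_distributive smooth_mul smooth_add.
Proof.
by move=> f g h; apply: smoothFun_ext => x Ax; rewrite !to_smoothE // mulrDl.
Qed.

HB.instance Definition _ := GRing.Zmodule_isComPzRing.Build (smoothFun A_open)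
  smooth_mulA smooth_mulC smooth_mul1 smooth_mulD.

(** The proof [Ax] is an argument because evaluation is a ring morphism only at points of [A]:
    elsewhere even the unit of the ring takes the value 0. *)
Definition smooth_eval x (Ax : A x) f : R := f x.
Arguments smooth_eval : simpl never.

Section Eval.
Variables (x : 'rV[R]_n) (Ax : A x).

Lemma smooth_eval_zmod : zmod_morphism (smooth_eval Ax).
Proof. by move=> f g; rewrite /smooth_eval !to_smoothE. Qed.
HB.instance Definition _ :=
  GRing.isZmodMorphism.Build _ _ (smooth_eval Ax) smooth_eval_zmod.

Lemma smooth_eval_monoid : monoid_morphism (smooth_eval Ax).
Proof. by split=> [|f g]; rewrite /smooth_eval !to_smoothE. Qed.
HB.instance Definition _ :=
  GRing.isMonoidMorphism.Build _ _ (smooth_eval Ax) smooth_eval_monoid.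
End Eval.

Lemma smooth_eval_inj f g :
  (forall x (Ax : A x), smooth_eval Ax f = smooth_eval Ax g) -> f = g.
Proof. by move=> fg; apply: smoothFun_ext => x Ax; exact: fg. Qed.

Definition smooth_partial i f : smoothFun A_open :=
  to_smooth (smooth_on_partial i (smooth_valP f)).

Arguments smooth_partial : simpl never.

Lemma smooth_partialE i f x : A x -> smooth_partial i f x = partial i f x.
Proof. exact: to_smoothE. Qed.

Lemma smooth_derivable i f x : A x -> derivable f x (delta_mx 0 i).
Proof. by move=> Ax; exact: (smooth_valP f [::] Ax).2. Qed.

Lemma smooth_partial_zmod i : zmod_morphism (smooth_partial i).
Proof.
move=> f g; apply: smoothFun_ext => x Ax; rewrite smooth_partialE //.
transitivity (partial i f x - partial i g x).
  have df := @smooth_derivable i f x Ax; have dg := @smooth_derivable i g x Ax.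
  rewrite /partial -(deriveB df dg); apply: (@partial_eq_on _ _ A A_open i) => //.
  by move=> y Ay; rewrite [LHS]to_smoothE // [X in _ + X]to_smoothE.
by rewrite -[RHS]/(smooth_eval Ax _) raddfB /= /smooth_eval !smooth_partialE.
Qed.
HB.instance Definition _ i :=
  GRing.isZmodMorphism.Build _ _ (smooth_partial i) (smooth_partial_zmod i).

Lemma smooth_partialM i f g :
  smooth_partial i (f * g) = smooth_partial i f * g + f * smooth_partial i g.
Proof.
apply: smooth_eval_inj => x Ax; rewrite rmorphD !rmorphM /= /smooth_eval.
rewrite !smooth_partialE //.
have df := @smooth_derivable i f x Ax; have dg := @smooth_derivable i g x Ax.
transitivity (f x *: partial i g x + g x *: partial i f x).
  rewrite /partial -(deriveM df dg); apply: (@partial_eq_on _ _ A A_open i) => //.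
  by move=> y Ay; rewrite [LHS]to_smoothE.
by rewrite addrC [g x *: _]mulrC.
Qed.

Lemma smooth_partialC i j f :
  smooth_partial i (smooth_partial j f) = smooth_partial j (smooth_partial i f).
Proof.
apply: smoothFun_ext => x Ax; rewrite [LHS](smooth_partialE _ _ Ax).
rewrite [RHS](smooth_partialE _ _ Ax).
rewrite (partial_eq_on A_open i Ax (smooth_partialE j f)).
rewrite (partial_eq_on A_open j Ax (smooth_partialE i f)).
exact: (partialC A_open i j (smooth_valP f) Ax).
Qed.

Lemma smooth_double_eq0 f : f + f = 0 -> f = 0.
Proof.
move=> ff; apply: smooth_eval_inj => x Ax; have := congr1 (smooth_eval Ax) ff.
by rewrite rmorphD !rmorph0; lra.
Qed.

Lemma smooth_partial_to_smooth i (f : 'rV[R]_n -> R) (fs : smooth_on A f) x :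
  A x -> smooth_partial i (to_smooth fs) x = partial i f x.
Proof.
move=> Ax; rewrite smooth_partialE //; apply: partial_eq_on Ax _ => // y Ay.
by rewrite to_smoothE.
Qed.

End SmoothRing.

Arguments to_smooth : simpl never.
Arguments smooth_eval : simpl never.
Arguments smooth_partial : simpl never.

(** * Metrics in a chart *)

Section LocalMetric.
Context {R : realType} {n : nat}.
Variables (A : set 'rV[R]_n) (A_open : open A) (g : 'rV[R]_n -> 'M[R]_n).
Hypothesis g_smooth : smooth_mx_on A g.
Hypothesis g_sym : forall x, A x -> (g x)^T = g x.
Hypothesis g_posdef : forall x, A x -> posdef (g x).

Local Notation K := (smoothFun A_open).
Local Notation d := (fun i : 'I_n => [the {additive K -> K} of smooth_partial i]).

Let g_unit x (Ax : A x) : g x \in unitmx := posdef_unit (g_posdef Ax).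

Lemma invmx_metric_sym x : A x -> (invmx (g x))^T = invmx (g x).
Proof. by move=> Ax; rewrite trmx_inv g_sym. Qed.

Definition smooth_metric : 'M[K]_n := \matrix_(i, j) to_smooth (g_smooth i j).

Definition smooth_inverse_metric : 'M[K]_n :=
  \matrix_(i, j) to_smooth (smooth_on_invmx A_open g_unit g_smooth i j).

Definition smooth_christoffel : 'I_n -> 'M[K]_n :=
  levi_civita d (smooth_cst 2^-1) smooth_metric smooth_inverse_metric.

Local Notation gK := smooth_metric.
Local Notation hK := smooth_inverse_metric.
Local Notation CK := smooth_christoffel.

Lemma eval_mx_inj p q (M N : 'M[K]_(p, q)) :
  (forall x (Ax : A x), map_mx (smooth_eval Ax) M = map_mx (smooth_eval Ax) N) ->
  M = N.
Proof.
move=> MN; apply/matrixP => i j; apply: smooth_eval_inj => x Ax.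
by have /matrixP/(_ i j) := MN x Ax; rewrite !mxE.
Qed.

Lemma eval_metric x (Ax : A x) : map_mx (smooth_eval Ax) gK = g x.
Proof. by apply/matrixP => i j; rewrite !mxE /smooth_eval to_smoothE. Qed.

Lemma eval_inverse_metric x (Ax : A x) : map_mx (smooth_eval Ax) hK = invmx (g x).
Proof. by apply/matrixP => i j; rewrite !mxE /smooth_eval to_smoothE. Qed.

Lemma eval_christoffel x (Ax : A x) i k l :
  smooth_eval Ax (CK i k l) = christoffel g l i k x.
Proof.
rewrite mxE rmorphM rmorph_sum /= {1}/smooth_eval to_smoothE //; congr (_ * _).
apply: eq_bigr => m _; rewrite rmorphM rmorphB rmorphD /= /smooth_eval !mxE.
by rewrite !smooth_partial_to_smooth // to_smoothE.
Qed.

Lemma eval_curvature x (Ax : A x) i j k l :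
  smooth_eval Ax (curvature d CK i j k l) = riemann g l i j k x.
Proof.
have eval_d a b : smooth_eval Ax (d a (CK b k l)) = partial a (christoffel g l b k) x.
  rewrite /= /smooth_eval smooth_partialE //.
  by apply: (partial_eq_on A_open) => // y Ay; rewrite -(eval_christoffel Ay).
rewrite curvatureE rmorphD rmorphB; congr (_ - _ + _).
- exact: eval_d.
- exact: eval_d.
rewrite rmorph_sum; apply: eq_bigr => m _.
rewrite rmorphB; congr (_ - _); rewrite rmorphM; congr (_ * _);
  exact: eval_christoffel.
Qed.

Lemma eval_ricci x (Ax : A x) :
  map_mx (smooth_eval Ax) (ricci_trace d CK) = ricci g x.
Proof.
apply/matrixP => j k; rewrite !mxE rmorph_sum; apply: eq_bigr => i _.
exact: eval_curvature.
Qed.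

Lemma smooth_inverse_metricl : hK *m gK = 1%:M.
Proof.
apply: eval_mx_inj => x Ax; rewrite map_mxM eval_metric eval_inverse_metric.
by rewrite map_mx1 mulVmx // g_unit.
Qed.

Lemma smooth_inverse_metricr : gK *m hK = 1%:M.
Proof.
apply: eval_mx_inj => x Ax; rewrite map_mxM eval_metric eval_inverse_metric.
by rewrite map_mx1 mulmxV // g_unit.
Qed.

Lemma smooth_metric_sym : gK^T = gK.
Proof. by apply: eval_mx_inj => x Ax; rewrite -map_trmx eval_metric g_sym. Qed.

Lemma smooth_inverse_metric_sym : hK^T = hK.
Proof.
apply: eval_mx_inj => x Ax.
by rewrite -map_trmx eval_inverse_metric invmx_metric_sym.
Qed.

Lemma smooth_christoffel_torsion_free i j l : CK i j l = CK j i l.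
Proof. exact: (levi_civita_torsion_free _ _ _ smooth_metric_sym). Qed.

Lemma smooth_christoffel_compat i : map_mx (d i) gK = CK i *m gK + gK *m (CK i)^T.
Proof.
apply: levi_civita_compat smooth_inverse_metricl smooth_metric_sym
  smooth_inverse_metric_sym _.
apply: smooth_eval_inj => x Ax; rewrite rmorphD rmorph1 [RHS]splitr div1r.
by congr (_ + _); exact: to_smoothE.
Qed.

Lemma eval_scalar x (Ax : A x) :
  smooth_eval Ax (\tr (ricci_operator d CK hK)) = scalar_curvature g x.
Proof.
rewrite -trace_map_mx map_mxM eval_ricci eval_inverse_metric.
apply: eq_bigr => i _; rewrite mxE; apply: eq_bigr => j _; rewrite mulrC.
by rewrite -{1}(invmx_metric_sym Ax) mxE.
Qed.

(** * Vector fields and the steady soliton equation in a chart *)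

Section Soliton.
Variable k : 'rV[R]_n -> 'rV[R]_n.
Hypothesis k_smooth : smooth_mx_on A k.

Definition smooth_vector : 'rV[K]_n := \row_i to_smooth (k_smooth 0 i).
Local Notation kK := smooth_vector.

Lemma eval_vector x (Ax : A x) : map_mx (smooth_eval Ax) kK = k x.
Proof. by apply/rowP => i; rewrite !mxE /smooth_eval to_smoothE. Qed.

Lemma eval_lie x (Ax : A x) :
  let B := map_mx (smooth_eval Ax) (covariant_derivative d CK kK) in
  lie_derivative k g x = B *m g x + g x *m B^T.
Proof.
move=> B; rewrite -(eval_metric Ax) /B map_trmx -!map_mxM -map_mxD.
apply/matrixP => i j.
rewrite [RHS]mxE.
rewrite -(lie_derivative_metric smooth_christoffel_compat
  smooth_christoffel_torsion_free).
rewrite [RHS](rmorph_sum (smooth_eval Ax)) [LHS]mxE; apply: eq_bigr => l _.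
rewrite !rmorphD !rmorphM /= /smooth_eval !mxE.
by rewrite !smooth_partial_to_smooth // !to_smoothE.
Qed.

Definition square_norm x : R := (k x *m g x *m (k x)^T) 0 0.

Lemma eval_square_norm x (Ax : A x) :
  smooth_eval Ax ((kK *m gK *m kK^T) 0 0) = square_norm x.
Proof.
by rewrite /square_norm -(eval_vector Ax) -(eval_metric Ax) map_trmx -!map_mxM [RHS]mxE.
Qed.

Lemma smooth_square_norm : smooth_on A square_norm.
Proof.
apply: (smooth_on_eq A_open _ (smooth_valP ((kK *m gK *m kK^T) 0 0))) => x Ax.
exact: eval_square_norm.
Qed.

Lemma derive_square_norm x : A x ->
  \sum_l k x 0 l * partial l square_norm x =
  (k x *m lie_derivative k g x *m (k x)^T) 0 0.
Proof.
move=> Ax.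
have := derivative_square_norm (@smooth_partialM _ _ _ _) smooth_christoffel_compat kK.
move=> /(congr1 (smooth_eval Ax)); rewrite (rmorph_sum (smooth_eval Ax)) => sumE.
rewrite (eval_lie Ax) -{2 3}(eval_vector Ax) -!(eval_metric Ax).
rewrite !map_trmx -!map_mxM -map_mxD -!map_mxM [RHS]mxE -[RHS]sumE.
apply: eq_bigr => l _; rewrite (rmorphM (smooth_eval Ax)); congr (_ * _).
  by rewrite -(eval_vector Ax) mxE.
rewrite /smooth_eval [RHS]smooth_partialE //.
by apply: (partial_eq_on A_open) => // y Ay; rewrite -(eval_square_norm Ay).
Qed.

Lemma steady_soliton_ricci_flat (S : R) :
  (forall x, A x -> scalar_curvature g x = S) ->
  (forall x, A x -> k x *m ricci g x = 0) ->
  (forall x, A x -> ricci g x + 2^-1 *: lie_derivative k g x = 0) ->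
  forall x, A x -> ricci g x = 0.
Proof.
move=> scalS k_ker soliton x Ax.
have k_kerK : kK *m ricci_trace d CK = 0.
  apply: eval_mx_inj => y Ay.
  by rewrite map_mxM eval_vector eval_ricci k_ker // map_mx0.
have dS i : d i (\tr (ricci_operator d CK hK)) = 0.
  apply: smooth_eval_inj => y Ay; rewrite rmorph0 /= /smooth_eval smooth_partialE //.
  rewrite (@partial_eq_on _ _ A A_open i _ (cst S)) //; first exact: derive_cst.
  by move=> z Az; rewrite -(scalS z Az) -(eval_scalar Az).
have := trace_covariant_ricci0 (@smooth_partialM _ _ _ _) (@smooth_partialC _ _ _ _)
  (@smooth_double_eq0 _ _ _ _) smooth_inverse_metricl smooth_inverse_metricr
  smooth_inverse_metric_sym smooth_christoffel_compat smooth_christoffel_torsion_free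
  k_kerK dS.
move=> /(congr1 (smooth_eval Ax)); rewrite rmorph0 -trace_map_mx !map_mxM.
rewrite eval_ricci eval_inverse_metric.
move: (soliton x Ax); rewrite (eval_lie Ax) /=.
set B := map_mx _ _; set T := ricci g x; set G := g x; set H := invmx G.
move=> TB trBT.
have TE : T = - (2^-1 *: (B *m G + G *m B^T)) by apply/eqP; rewrite -addr_eq0 TB.
have Gsym : G^T = G by exact: g_sym.
have Hsym : H^T = H by exact: invmx_metric_sym.
(* The symmetry of the Ricci tensor is read off the soliton equation, whose other term is
   symmetric. *)
have Tsym : T^T = T.
  by rewrite TE linearN linearZ /= linearD /= !trmx_mul trmxK Gsym addrC.
have GH : G *m H = 1%:M by rewrite mulmxV // g_unit.
apply: (posdef_trace_sqr_eq0 Tsym Hsym).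
  by apply: posdef_inv => //; exact: g_posdef.
(* [H *m T *m H] is the Ricci tensor with both indices raised. Its pairing with [B *m G] is the
   trace in [trBT], and transposition gives the same for [G *m B^T]; by [TE] its pairing with [T],
   which is |Ric|^2, vanishes. *)
have tr1 : \tr (B *m G *m (H *m T *m H)) = 0.
  by rewrite -!mulmxA (mulmxA G) GH mul1mx trBT.
have tr2 : \tr (G *m B^T *m (H *m T *m H)) = 0.
  rewrite -mxtrace_tr trmx_mul mxtrace_mulC -[RHS]tr1; congr (\tr (_ *m _)).
    by rewrite trmx_mul trmxK Gsym.
  by rewrite !trmx_mul Tsym Hsym mulmxA.
have -> : T *m H *m T *m H = T *m (H *m T *m H) by rewrite !mulmxA.
rewrite {1}TE mulNmx -scalemxAl mulmxDl linearN linearZ /= linearD /= tr1 tr2.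
by rewrite addr0 mulr0 oppr0.
Qed.

End Soliton.
End LocalMetric.

(** Raising an index makes the curvature skew in both pairs of indices, and Ricci-flatness becomes
    the vanishing of a trace of an upper with a lower index. This is linear algebra at the single
    point [x], with no metric in it; [g] then lowers the index again. *)
Lemma ricci_flat_flat (R : realType) (A : set 'rV[R]_3) (g : 'rV[R]_3 -> 'M[R]_3) :
  open A -> smooth_mx_on A g -> (forall x, A x -> (g x)^T = g x) ->
  (forall x, A x -> posdef (g x)) ->
  forall x, A x -> ricci g x = 0 ->
  forall l i j k, riemann g l i j k x = 0.
Proof.
move=> A_open g_smooth g_sym g_posdef x Ax ric0 l i j k.
pose d i := [the {additive smoothFun A_open -> smoothFun A_open} of smooth_partial i].
pose h := smooth_inverse_metric A_open g_smooth g_posdef.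
pose C := smooth_christoffel A_open g_smooth g_posdef.
have hg := smooth_inverse_metricl A_open g_smooth g_posdef.
have gh := smooth_inverse_metricr A_open g_smooth g_posdef.
have h_sym := smooth_inverse_metric_sym A_open g_smooth g_sym g_posdef.
have compat := smooth_christoffel_compat A_open g_smooth g_sym g_posdef.
have dM := @smooth_partialM R 3 A A_open; have dC := @smooth_partialC R 3 A A_open.
pose Q i j := map_mx (smooth_eval Ax) (raised_curvature d C h i j).
have Q0 : Q i j = 0.
  apply: double_bivector_trace_eq0 => [a b c e|a b c e|b e].
  - by rewrite /Q raised_curvatureC map_mxN mxE.
  - rewrite /Q [LHS]mxE [X in - X]mxE -(rmorphN (smooth_eval Ax)).
    by congr (smooth_eval Ax _); exact: (raised_curvature_skew dM dC hg gh h_sym compat).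
  - have := congr1 (fun M => (M *m invmx (g x)) b e) ric0; rewrite /= mul0mx [RHS]mxE.
    rewrite -(eval_ricci A_open g_smooth g_posdef Ax).
    rewrite -(eval_inverse_metric A_open g_smooth g_posdef Ax) -map_mxM [LHS]mxE.
    have -> := ricci_operatorE d C h_sym b e.
    rewrite (rmorph_sum (smooth_eval Ax)) => QE.
    by rewrite -[RHS]QE; apply: eq_bigr => a _; rewrite [LHS]mxE.
rewrite -(eval_curvature A_open g_smooth g_posdef Ax).
have -> : curvature d C i j = smooth_metric A_open g_smooth *m raised_curvature d C h i j.
  by rewrite /raised_curvature mulmxA gh mul1mx.
have := congr1 (fun M => (g x *m M) k l) Q0; rewrite mulmx0 [RHS]mxE => <-.
by rewrite /Q -(eval_metric A_open g_smooth Ax) -map_mxM [RHS]mxE.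
Qed.

(** * Maximum principle *)

Section MaximumPrinciple.
Context {R : realType} {n : nat} {M : smoothManifold R n}.
Variables (g : riemannianMetric M) (k : vectorField M).

Lemma square_norm_transform c e p : atlas c -> atlas e ->
  chart_dom c p -> chart_dom e p ->
  square_norm (g e) (k e) (chart_map e p) = square_norm (g c) (k c) (chart_map c p).
Proof.
move=> ac ae cp ep; rewrite /square_norm (vf_transform k ac ae cp ep).
by rewrite (metric_transform g ac ae cp ep) trmx_mul !mulmxA.
Qed.

Lemma square_norm_max : closed_manifold M -> [set: M] !=set0 ->
  exists c p, [/\ atlas c, chart_dom c p &
    \forall y \near chart_map c p,
      square_norm (g c) (k c) y <= square_norm (g c) (k c) (chart_map c p)].
Proof.
move=> M_closed M_nonempty.
(* A chart is chosen around each point. By the transformation laws [F] does not depend on the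
   choice, so near [p] it is given by the single chart [ch p], which yields continuity. *)
pose ch p := s2val (cid2 (atlas_cover (s := M) p)).
have ch_atlas p : atlas (ch p) := s2valP (cid2 (atlas_cover (s := M) p)).
have ch_dom p : chart_dom (ch p) p := s2valP' (cid2 (atlas_cover (s := M) p)).
pose F p := square_norm (g (ch p)) (k (ch p)) (chart_map (ch p) p).
have FE c p : atlas c -> chart_dom c p ->
    F p = square_norm (g c) (k c) (chart_map c p).
  by move=> ac cp; apply: square_norm_transform.
have F_cont : continuous F.
  move=> p; pose c := ch p.
  have map_cont : {for p, continuous (chart_map c)}.
    have := @chart_map_continuous _ _ _ c.
    rewrite continuous_open_subspace; last exact: chart_dom_open.
    by apply; rewrite inE; exact: ch_dom.
  have sq_cont : {for chart_map c p, continuous (square_norm (g c) (k c))}.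
    have sq_smooth := smooth_square_norm (@chart_img_open _ _ _ c)
      (metric_smooth g (ch_atlas p)) (vf_smooth k (ch_atlas p)).
    by have [] := sq_smooth [::] (chart_map c p) (imageP _ (ch_dom p)).
  have Fc : {for p, continuous (square_norm (g c) (k c) \o chart_map c)}.
    exact: continuous_comp.
  rewrite /continuous_at (FE c p (ch_atlas p) (ch_dom p)); apply: cvg_trans Fc.
  apply: near_eq_cvg; apply: (@filterS _ _ _ (chart_dom c)).
    by move=> q cq; rewrite (FE c q (ch_atlas p) cq).
  by apply: open_nbhs_nbhs; split; [exact: chart_dom_open | exact: ch_dom].
have [p _ Fmax] := compact_EVT_max M_nonempty M_closed (continuous_subspaceT F_cont).
exists (ch p), p; split => //.
apply: (@filterS _ _ _ (chart_img (ch p))); last first.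
  by apply: open_nbhs_nbhs; split; [exact: chart_img_open | exact: imageP].
move=> _ [q cq <-]; rewrite -!FE //; apply: Fmax; exact: in_setT.
Qed.

Lemma soliton_kernel_steady (lambda : R) : closed_manifold M -> [set: M] !=set0 ->
  nowhere_vanishing k -> in_ricci_kernel g k -> ricci_soliton g k lambda ->
  lambda = 0.
Proof.
move=> M_closed M_nonempty k_neq0 k_ker k_soliton.
have [c [p [ac cp sq_max]]] := square_norm_max M_closed M_nonempty.
set x := chart_map c p in sq_max; have cx : chart_img c x by exact: imageP.
have c_open := @chart_img_open _ _ _ c.
have sq_smooth := smooth_square_norm c_open (metric_smooth g ac) (vf_smooth k ac).
have := derive_square_norm c_open (metric_smooth g ac)
  (fun y cy => Defs.metric_sym g ac cy) (fun y cy => metric_posdef g ac cy)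
  (vf_smooth k ac) cx.
rewrite big1 => [sq0|l _]; last first.
  rewrite [partial _ _ _](_ : _ = 0) ?mulr0 //; apply: derive_eq0_at_max => //.
    exact: (sq_smooth [::] x cx).2.
  apply: (@filterS _ _ _ (chart_img c)); last by apply: open_nbhs_nbhs; split.
  by move=> y cy; exact: (sq_smooth [::] y cy).2.
(* The soliton equation is doubled, which turns the constant lambda/2 into lambda; the Ricci term
   then drops out on contraction with [k]. *)
have lieE : lie_derivative (k c) (g c) x = lambda *: g c x - 2 *: ricci (g c) x.
  have := congr1 ( *:%R 2) (k_soliton c x ac cx).
  rewrite scalerDr !scalerA mulfV ?pnatr_eq0 // scale1r mulrC divfK ?pnatr_eq0 //.
  by move=> <-; rewrite addrAC subrr add0r.
have sq_gt0 := metric_posdef g ac cx (k_neq0 c x ac cx).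
move: sq0; rewrite lieE mulmxBr mulmxBl -!scalemxAr k_ker // scaler0 mul0mx subr0.
rewrite -scalemxAl [RHS]mxE => /esym/eqP; rewrite mulf_eq0 (gt_eqF sq_gt0) orbF.
by move/eqP.
Qed.

End MaximumPrinciple.

Theorem lemma2 (R : realType) (M : smoothManifold R 3)
    (g : riemannianMetric M) (S : R) (k : vectorField M) (lambda : R)
    (M_nonempty : ([set: M] !=set0)%classic)
    (M_closed : closed_manifold M)
    (g_scal : has_constant_scalar_curvature g S)
    (k_neq0 : nowhere_vanishing k)
    (k_ker : in_ricci_kernel g k)
    (k_soliton : ricci_soliton g k lambda) :
  lambda = S /\ (S = 0%R -> flat g).
Proof.
have lambda0 := soliton_kernel_steady M_closed M_nonempty k_neq0 k_ker k_soliton.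
have ric0 c x : atlas c -> chart_img c x -> ricci (g c) x = 0.
  move=> ac; apply: (steady_soliton_ricci_flat (@chart_img_open _ _ _ c)
    (metric_smooth g ac) (fun y cy => Defs.metric_sym g ac cy)
    (fun y cy => metric_posdef g ac cy) (vf_smooth k ac) (S := S)).
  - by move=> y cy; exact: g_scal.
  - by move=> y cy; exact: k_ker.
  - by move=> y cy; rewrite k_soliton // lambda0 mul0r scale0r.
split=> [|_ c x ac cx l i j m].
  have [p _] := M_nonempty; have [c ac cp] := atlas_cover p.
  have cx : chart_img c (chart_map c p) by exact: imageP.
  rewrite lambda0 -(g_scal c _ ac cx) /scalar_curvature ric0 //.
  by apply/esym/big1 => i _; apply: big1 => j _; rewrite mxE mulr0.
exact: (ricci_flat_flat (@chart_img_open _ _ _ c) (metric_smooth g ac)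
  (fun y cy => Defs.metric_sym g ac cy) (fun y cy => metric_posdef g ac cy) cx
  (ric0 c x ac cx)).
Qed.
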